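(* For all integers $d,m$ there exists a finite set of graphs $\mathcal F_{d,m}$ such that a graph $G$ belongs to $\mathrm{TM}_d^m$ if and only if $G$ has no induced subgraph isomorphic to a member of $\mathcal F_{d,m}$. Similarly, for every integer $n$ there exists a finite set of graphs $\mathcal F'_n$ such that $G\in\mathrm{SC}_n$ if and only if $G$ has no induced subgraph isomorphic to a member of $\mathcal F'_n$.
   Context: All graphs are finite, simple and undirected. A tree-model of $m$ colours and depth $d$ of a graph $G$ is a rooted tree $T$ with a set $S\subseteq\{1,\dots,m\}^2\times\{1,\dots,d\}$ such that: every root-to-leaf path of $T$ has length exactly $d$; the leaves of $T$ are exactly $V(G)$; each leaf gets one of the colours $1,\dots,m$; $(i,j,\ell)\in S$ iff $(j,i,\ell)\in S$; and for distinct $u,v\in V(G)$ coloured $i,j$ at distance $2\ell$ in $T$, $uv\in E(G)$ iff $(i,j,\ell)\in S$. $\mathrm{TM}_d^m$ is the class of graphs having such a tree-model. For a graph $G$ and $X\subseteq V(G)$, $\overline{G}^X$ is obtained from $G$ by complementing the adjacency between all pairs of distinct vertices of $X$ (other pairs unchanged). $\mathrm{SC}_0=\{K_1\}$, and $\mathrm{SC}_{n+1}$ consists of all graphs $\overline{H}^X$ where $H$ is a disjoint union of finitely many (at least one) graphs from $\mathrm{SC}_n$ and $X\subseteq V(H)$. *)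

(* Defs.v *)
From HB Require Import structures.
From mathcomp Require Import all_boot.

Set Implicit Arguments.
Unset Strict Implicit.
Unset Printing Implicit Defensive.

(* Graphs have at least one vertex.  A rooted tree always has a leaf and the
   disjoint unions building SC are nonempty, so the graph with no vertex lies
   in none of the classes below although it is an induced subgraph of every
   graph; admitting it would make any forbidden-subgraph statement fail. *)
Record graph := Graph {
  vertex :> finType;
  adj : rel vertex;
  adj_sym : symmetric adj;
  adj_irrefl : irreflexive adj;
  vertex_gt0 : 0 < #|vertex|
}.

Definition iso (G H : graph) : Prop :=
  exists f : G -> H, bijective f /\ forall x y, adj (f x) (f y) = adj x y.

Section Induced.
Variables (G : graph) (X : {set G}) (X_gt0 : 0 < #|X|).

Let sub := {x : G | x \in X}.
Definition induced_rel : rel sub := fun x y => adj (val x) (val y).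

Fact induced_sym : symmetric induced_rel.
Proof. by move=> x y; apply: adj_sym. Qed.

Fact induced_irrefl : irreflexive induced_rel.
Proof. by move=> x; apply: adj_irrefl. Qed.

Fact induced_gt0 : 0 < #|{: sub}|.
Proof. by rewrite card_sig. Qed.

Definition induced : graph := Graph induced_sym induced_irrefl induced_gt0.
End Induced.

Definition has_induced (G H : graph) : Prop :=
  exists (X : {set G}) (X_gt0 : 0 < #|X|), iso (induced X_gt0) H.

Definition is_dist (G : graph) (x y : G) (k : nat) : Prop :=
  (exists p : seq G, [/\ path (@adj G) x p, last x p = y & size p = k]) /\
  (forall p : seq G, path (@adj G) x p -> last x p = y -> k <= size p).

Definition connected (G : graph) : Prop :=
  forall x y : G, connect (@adj G) x y.

(* A two-element [ucycle] is a single edge traversed back and forth. *)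
Definition acyclic (G : graph) : Prop :=
  forall c : seq G, ucycle (@adj G) c -> size c <= 2.

Definition is_tree (T : graph) : Prop := connected T /\ acyclic T.

Definition child (T : graph) (r x y : T) : Prop :=
  adj x y /\ exists k, is_dist r x k /\ is_dist r y k.+1.

(* Leaves of a rooted tree are the childless nodes: the root is a leaf only
   when it is the whole tree, even if it has degree one. *)
Definition leaf (T : graph) (r x : T) : Prop := ~ exists y, child r x y.

(* [nu] identifies V(G) with the set of leaves.  Colours 1..m are ['I_m], and
   [l : 'I_d] stands for the level l.+1 in 1..d. *)
Record tree_model (d m : nat) (G T : graph) (r : T) (nu : G -> T)
    (col : G -> 'I_m) (S : {set 'I_m * 'I_m * 'I_d}) : Prop := TreeModel {
  tm_tree : is_tree T;
  tm_depth : forall p : seq T, path (@adj T) r p -> uniq (r :: p) ->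
    leaf r (last r p) -> size p = d;
  tm_inj : injective nu;
  tm_leaves : forall t : T, leaf r t <-> exists v : G, nu v = t;
  tm_sym : forall i j l, ((i, j, l) \in S) = ((j, i, l) \in S);
  tm_adj : forall (u v : G) (l : 'I_d), u != v ->
    is_dist (nu u) (nu v) (2 * l.+1) -> adj u v = ((col u, col v, l) \in S)
}.

Definition TM (d m : nat) (G : graph) : Prop :=
  exists (T : graph) (r : T) (nu : G -> T) (col : G -> 'I_m)
         (S : {set 'I_m * 'I_m * 'I_d}), tree_model r nu col S.

Section LocalComplement.
Variables (G : graph) (X : {set G}).

Definition lcompl_rel : rel G := fun x y =>
  if [&& x != y, x \in X & y \in X] then ~~ adj x y else adj x y.

Fact lcompl_sym : symmetric lcompl_rel.
Proof.
move=> x y; rewrite /lcompl_rel eq_sym adj_sym.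
by rewrite [(y \in X) && _]andbC.
Qed.

Fact lcompl_irrefl : irreflexive lcompl_rel.
Proof. by move=> x; rewrite /lcompl_rel eqxx adj_irrefl. Qed.

Definition lcompl : graph := Graph lcompl_sym lcompl_irrefl (vertex_gt0 G).
End LocalComplement.

(* The index type ['I_k.+1] makes the union range over at least one graph. *)
Section DisjointUnion.
Variables (k : nat) (H : 'I_k.+1 -> graph).

Let V : finType := {i : 'I_k.+1 & H i}.
Definition dunion_rel : rel V := fun x y =>
  (tag x == tag y) && adj (tagged x) (tagged_as x y).

Fact dunion_sym : symmetric dunion_rel.
Proof.
move=> [i x] [j y]; rewrite /dunion_rel /=; case: (eqVneq i j) => //= eij.
by case: _ / eij y => y; rewrite !tagged_asE adj_sym.
Qed.

Fact dunion_irrefl : irreflexive dunion_rel.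
Proof. by move=> [i x]; rewrite /dunion_rel eqxx tagged_asE adj_irrefl. Qed.

Fact dunion_gt0 : 0 < #|V|.
Proof.
have /card_gt0P[x _] := vertex_gt0 (H ord0).
by apply/card_gt0P; exists (Tagged (fun i => H i : Type) x).
Qed.

Definition dunion : graph := Graph dunion_sym dunion_irrefl dunion_gt0.
End DisjointUnion.

Section K1.
Definition K1_rel : rel unit := fun _ _ => false.

Fact K1_sym : symmetric K1_rel. Proof. by []. Qed.

Fact K1_irrefl : irreflexive K1_rel. Proof. by []. Qed.

Fact K1_gt0 : 0 < #|{: unit}|. Proof. by rewrite card_unit. Qed.

Definition K1 : graph := Graph K1_sym K1_irrefl K1_gt0.
End K1.

Fixpoint SC (n : nat) (G : graph) : Prop :=
  if n is n'.+1 then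
    exists (k : nat) (H : 'I_k.+1 -> graph) (X : {set dunion H}),
      (forall i, SC n' (H i)) /\ iso G (lcompl X)
  else iso G K1.

(* Main.v *)
From Stdlib Require Import Classical IndefiniteDescription.
Require Import Defs.
From mathcomp Require Import all_boot.

Set Implicit Arguments.
Unset Strict Implicit.
Unset Printing Implicit Defensive.

(** Both classes are described by ultrametrics.  A tree-model is the same as an
    ultrametric [h <= d] on the vertices (half the distance between leaves)
    together with a colouring, such that adjacency of [x != y] depends only on
    [h x y] and the two colours; in [SC_n] the colour of a vertex records in
    which of the [n] complemented sets it lies.  In this form both classes are
    visibly hereditary.

    For fixed depth, palette and adjacency rule, such graphs are well-quasi-ordered
    by induced subgraphs: a ball of radius [d + 1] is a finite sequence of balls of
    radius [d], so Higman's lemma applies by induction on [d].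

    Deleting a vertex [v] from a minimal obstruction gives a member of the class;
    putting [v] at distance [d + 1] from everything and recording adjacency to
    [v] in the colours shows that all minimal obstructions lie in one fixed
    family of the same kind.  They form an antichain there, hence are finite in
    number. *)

(** * Higman's lemma *)

Lemma dependent_choice (X : Type) (R : X -> X -> Prop) (x0 : X) :
  (forall x, exists y, R x y) ->
  exists f : nat -> X, f 0 = x0 /\ forall n, R (f n) (f n.+1).
Proof.
move=> /functional_choice [g gP].
by exists (fun n => iter n g x0); split => // n; apply: gP.
Qed.

Definition wqo (X : Type) (R : X -> X -> Prop) : Prop :=
  forall f : nat -> X, exists i j, i < j /\ R (f i) (f j).

Lemma wqo_finType_eq (C : finType) : wqo (@eq C).
Proof.
move=> f; apply: NNPP => bad.
have finj : injective (fun i : 'I_#|C|.+1 => f i).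
  move=> i j eqf; apply: val_inj => /=.
  by case: (ltngtP i j) => // lt; case: bad; [exists i, j | exists j, i].
have := max_card (mem (codom (fun i : 'I_#|C|.+1 => f i))).
by rewrite card_codom // card_ord ltnn.
Qed.

(** Call an index terminal if no later term dominates its own. Infinitely many terminal indices
    would give a sequence contradicting [wqo R], so from some [N] on every index has a later
    dominating one, and iteration gives [phi]. *)
Lemma wqo_increasing_subseq (X : Type) (R : X -> X -> Prop) (a : nat -> X) :
  (forall x y z, R x y -> R y z -> R x z) -> wqo R ->
  exists phi : nat -> nat,
    forall i j, i < j -> phi i < phi j /\ R (a (phi i)) (a (phi j)).
Proof.
move=> Rtr wR.
pose up n k := n < k /\ R (a n) (a k).
have uptr n k l : up k n -> up n l -> up k l.
  by move=> [k1 r1] [k2 r2]; split; [apply: ltn_trans k2 | apply: Rtr r2].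
have [N NP] : exists N, forall n, N <= n -> exists k, up n k.
  apply: NNPP => noN.
  pose terminal n := ~ exists k, up n k.
  have next N : exists n, N < n /\ terminal n.
    apply: NNPP => nt; apply: noN; exists N.+1 => n Nn.
    by apply: NNPP => tn; apply: nt; exists n.
  have [b [_ bP]] := dependent_choice 0 next.
  (* The start [b 0] need not be terminal, hence the shift by one. *)
  have bmono : {homo (fun n => b n.+1) : i j / i < j}.
    by apply: homo_ltn => [y x z|i]; [apply: ltn_trans | case: (bP i.+1)].
  have [i [j [ij Rij]]] := wR (fun n => a (b n.+1)).
  by case: (bP i) => _; apply; exists (b j.+1); split; first exact: bmono.
have next n : exists k, N <= n -> N <= k /\ up n k.
  have [Nn|nN] := leqP N n; last by exists 0.
  have [k [nk Rk]] := NP n Nn.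
  by exists k => _; split; first exact: leq_trans Nn (ltnW nk).
have [phi [phi0 phiP]] := dependent_choice N next.
have geN n : N <= phi n.
  by elim: n => [|n IH]; [rewrite phi0 | case: (phiP n IH)].
exists phi.
apply: (@homo_ltn _ phi up uptr) => i.
by case: (phiP i (geN i)).
Qed.

(** Higman's ordering of finite sequences, by recursion on the target, whose head is either skipped
    or matched with the head of [s]. *)
Fixpoint subseq_emb (X : Type) (R : X -> X -> Prop) (s t : seq X) : Prop :=
  match t with
  | [::] => s = [::]
  | y :: t' =>
      subseq_emb R s t' \/
      (if s is x :: s' then R x y /\ subseq_emb R s' t' else True)
  end.

Lemma subseq_emb_nil (X : Type) (R : X -> X -> Prop) (t : seq X) :
  subseq_emb R [::] t.
Proof. by case: t => //= *; right. Qed.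

(** Nash-Williams' construction: terms are fixed one by one, the [n]-th of least size among the bad
    sequences that share the terms already fixed. *)
Lemma minimal_bad_sequence (Y : Type) (E : Y -> Y -> Prop) (sz : Y -> nat) :
  ~ wqo E ->
  exists m : nat -> Y, (forall i j, i < j -> ~ E (m i) (m j)) /\
    forall n (g : nat -> Y), (forall i j, i < j -> ~ E (g i) (g j)) ->
      (forall i, i < n -> g i = m i) -> sz (m n) <= sz (g n).
Proof.
move=> nwqo; pose bad g := forall i j : nat, i < j -> ~ E (g i) (g j).
have [f fbad] : exists f, bad f.
  apply: NNPP => nob; apply: nwqo => f; apply: NNPP => nog; apply: nob.
  by exists f => i j ij Eij; apply: nog; exists i, j.
(* A state [(n, g)] is a sequence [g] whose first [n] terms are fixed. Badness is a premise because
   dependent choice needs a successor of every state. *)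
pose step (p q : nat * (nat -> Y)) := q.1 = p.1.+1 /\ (bad p.2 -> [/\ bad q.2,
  forall i, i < p.1 -> q.2 i = p.2 i &
  forall g, bad g -> (forall i, i < p.1 -> g i = p.2 i) ->
    sz (q.2 p.1) <= sz (g p.1)]).
have next p : exists q, step p q.
  case: p => n g0; have [bg0|nb] := classic (bad g0); last first.
    by exists (n.+1, g0); split.
  pose good k := exists g, [/\ bad g, forall i, i < n -> g i = g0 i
                             & sz (g n) = k].
  have [k [g [bg agr szg]] kmin] : exists2 k, good k &
      forall k', good k' -> k <= k'.
    have : good (sz (g0 n)) by exists g0.
    elim/ltn_ind: (sz (g0 n)) => k IH gk.
    have [[k' [lt gk']]|no] := classic (exists k', k' < k /\ good k').
      exact: IH gk'.
    by exists k => // k' gk'; rewrite leqNgt; apply/negP => lt; apply: no; exists k'.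
  exists (n.+1, g); split => // _; split => //= g' bg' agr'.
  by rewrite szg; apply: kmin; exists g'.
have [p [p0 pP]] := dependent_choice (0, f) next.
have p1 n : (p n).1 = n by elim: n => [|n IH]; rewrite ?p0 // (proj1 (pP n)) IH.
have p2 n : bad (p n).2.
  by elim: n => [|n IH]; [rewrite p0 | have [] := proj2 (pP n) IH].
(* Diagonal limit: stage [n + 1] settles term [n], and later stages keep it. *)
pose m n := (p n.+1).2 n.
have agree n i : i < n -> (p n).2 i = m i.
  elim: n => // n IH; rewrite ltnS leq_eqVlt => /predU1P[->//|lt].
  have [_ agr _] := proj2 (pP n) (p2 n).
  by rewrite agr ?IH // p1.
exists m; split => [i j ij|n g bg agr].
  rewrite -(agree j.+1 i (ltnW ij)) -(agree j.+1 j (leqnn _)).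
  exact: p2 j.+1 i j ij.
case: (proj2 (pP n) (p2 n)) => _ _ /(_ g bg); rewrite p1; apply => i lt.
by rewrite agr ?agree.
Qed.

(** In a minimal bad sequence, choose [phi] along which the heads increase. Keeping the terms before
    [phi 0] and continuing with the tails of the terms along [phi] gives a bad sequence with a
    shorter term at [phi 0], a contradiction. *)
Theorem higman (X : Type) (R : X -> X -> Prop) :
  (forall x y z, R x y -> R y z -> R x z) -> wqo R -> wqo (subseq_emb R).
Proof.
move=> Rtr wR; apply: NNPP => /(minimal_bad_sequence size) [m [mbad mmin]].
have mne n : m n <> [::].
  by move=> m0; apply: (mbad n n.+1) => //; rewrite m0; apply: subseq_emb_nil.
have [x0 _] : exists x0 : X, True by case E: (m 0) (mne 0) => [|x s] // _; exists x.
have mE n : m n = head x0 (m n) :: behead (m n) by case: (m n) (mne n).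
have [phi phiP] := wqo_increasing_subseq (fun n => head x0 (m n)) Rtr wR.
have phi_ge i : phi 0 <= phi i.
  by case: i => // i; have [/ltnW] := phiP 0 i.+1 isT.
pose g n := if n < phi 0 then m n else behead (m (phi (n - phi 0))).
suff gbad : forall i j, i < j -> ~ subseq_emb R (g i) (g j).
  have := mmin (phi 0) g gbad; rewrite /g ltnn subnn size_behead => H.
  have /H: forall i, i < phi 0 -> (if i < phi 0 then m i else
      behead (m (phi (i - phi 0)))) = m i by move=> i ->.
  by rewrite {1}mE /= size_behead ltnn.
move=> i j ij; rewrite /g.
have [jl|jg] := ltnP j (phi 0); first by rewrite (ltn_trans ij jl); apply: mbad.
have [il|ig] := ltnP i (phi 0).
  move=> e; apply: (mbad i (phi (j - phi 0))).
    exact: leq_trans il (phi_ge _).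
  by rewrite [m (phi _)]mE /=; left.
have [|lt r] := phiP (i - phi 0) (j - phi 0); first exact: ltn_sub2r (leq_ltn_trans ig ij) ij.
move=> e; apply: (mbad _ _ lt).
by rewrite [m (phi (i - _))]mE [m (phi (j - _))]mE; right.
Qed.

(** * Ultrametric graphs and finite obstruction sets *)

Lemma has_inducedP (G H : graph) :
  has_induced G H <->
  exists f : H -> G, injective f /\ forall x y, adj (f x) (f y) = adj x y.
Proof.
split=> [[X [X_gt0 [f [[g fK gK] fadj]]]]|[f [finj fadj]]].
  exists (fun x => val (g x)); split=> [x y /val_inj /(can_inj gK) //|x y].
  by rewrite -[RHS](congr2 (@adj H) (gK x) (gK y)) fadj.
have X_gt0 : 0 < #|[set f x | x in H]|.
  by rewrite card_imset // vertex_gt0.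
exists [set f x | x in H], X_gt0.
have inv (y : induced X_gt0) : exists x, f x = val y.
  by case: y => y /= /imsetP[x _ ->]; exists x.
have [g gP] := fin_all_exists inv.
exists g; split => [|x y]; last by rewrite -fadj !gP.
exists (fun x => Sub (f x) (imset_f f (isT : x \in H))) => x.
  by apply: val_inj; rewrite /= gP.
by apply: finj; rewrite gP.
Qed.

Lemma has_induced_refl (G : graph) : has_induced G G.
Proof. by apply/has_inducedP; exists id; split. Qed.

Lemma has_induced_trans (G H K : graph) :
  has_induced G H -> has_induced H K -> has_induced G K.
Proof.
move=> /has_inducedP [f [finj fadj]] /has_inducedP [g [ginj gadj]].
apply/has_inducedP; exists (f \o g); split; first exact: inj_comp.
by move=> x y; rewrite /= fadj gadj.
Qed.

(** [um_trans] is the strong triangle inequality, phrased so that each relation [h x y <= i] is an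
    equivalence; its classes are the closed balls of radius [i]. *)
Record ultrametric (V : finType) (h : V -> V -> nat) : Prop := Ultrametric {
  um_eq0 : forall x y, (h x y == 0) = (x == y);
  um_sym : forall x y, h x y = h y x;
  um_trans : forall i x y z, h x y <= i -> h y z <= i -> h x z <= i
}.

Section UltrametricTheory.
Variables (V : finType) (h : V -> V -> nat).
Hypothesis hU : ultrametric h.

Lemma um_refl x : h x x = 0.
Proof. by apply/eqP; rewrite (um_eq0 hU). Qed.

Lemma um_le0 x y : (h x y <= 0) = (x == y).
Proof. by rewrite leqn0 (um_eq0 hU). Qed.

Lemma um_lel i x y z : h x y <= i -> (h x z <= i) = (h y z <= i).
Proof.
move=> xy; apply/idP/idP => H; last exact: (um_trans hU xy).
by apply: (um_trans hU _ H); rewrite (um_sym hU).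
Qed.

Lemma um_ler i x y z : h x y <= i -> (h z x <= i) = (h z y <= i).
Proof. by rewrite ![h z _](um_sym hU); apply: um_lel. Qed.

(** [pick] depends only on the set it picks from, so all points of a ball get the same
    representative. *)
Definition urep (i : nat) (x : V) : V := odflt x [pick y | h x y <= i].

Lemma urep_le i x : h x (urep i x) <= i.
Proof. by rewrite /urep; case: pickP => //= _; rewrite um_refl. Qed.

Lemma urep_eq i x y : (urep i x == urep i y) = (h x y <= i).
Proof.
apply/eqP/idP => [e|xy].
  by rewrite (um_ler x (urep_le i y)) -e urep_le.
rewrite /urep (eq_pick (fun z => um_lel z xy)).
by case: pickP => //= /(_ y); rewrite um_refl.
Qed.

Lemma urep_id i j x : i <= j -> urep j (urep i x) = urep j x.
Proof.
move=> ij; apply/eqP; rewrite urep_eq (um_sym hU).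
exact: leq_trans (urep_le i x) ij.
Qed.
End UltrametricTheory.

(** * Well-quasi-ordering of balls in coloured ultrametric spaces *)

Section UltraStructures.
Variable C : finType.

(* A structure pointed at [us_pt] stands, at radius [d], for its closed ball of
   radius [d] around that point. *)
Record ustruct := UStruct {
  us_V : finType;
  us_h : us_V -> us_V -> nat;
  us_col : us_V -> C;
  us_um : ultrametric us_h;
  us_pt : us_V
}.

(** [f] is constrained on the ball only; preserving distances makes it injective there. *)
Definition ball_emb (d : nat) (s t : ustruct) : Prop :=
  exists f : us_V s -> us_V t,
    forall x, us_h (us_pt s) x <= d ->
      [/\ us_h (us_pt t) (f x) <= d, us_col (f x) = us_col x
        & forall y, us_h (us_pt s) y <= d -> us_h (f x) (f y) = us_h x y].

Lemma ball_emb_trans d s t u :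
  ball_emb d s t -> ball_emb d t u -> ball_emb d s u.
Proof.
move=> [f fP] [g gP]; exists (g \o f) => x xs.
have [fx fc fh] := fP x xs; have [gx gc gh] := gP _ fx.
split=> [//||y ys /=]; first by rewrite /= gc.
by have [fy _ _] := fP y ys; rewrite gh ?fh.
Qed.

Definition recenter (s : ustruct) (x : us_V s) : ustruct :=
  UStruct (@us_col s) (us_um s) x.

Definition ball_reps (d : nat) (s : ustruct) : seq (us_V s) :=
  [seq x <- enum (us_V s) |
    (us_h (us_pt s) x <= d.+1) && (urep (@us_h s) d x == x)].

(** The order of the entries is forgotten and an injection kept. Uniqueness of [s] allows the
    definition by cases on [z == x]; uniqueness of [t] gives injectivity. *)
Lemma subseq_emb_map (S T : eqType) (X : Type) (R : X -> X -> Prop)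
    (f : S -> X) (g : T -> X) (t0 : T) (s : seq S) (t : seq T) :
  uniq s -> uniq t -> subseq_emb R (map f s) (map g t) ->
  exists k : S -> T, {in s &, injective k} /\
    forall x, x \in s -> k x \in t /\ R (f x) (g (k x)).
Proof.
elim: t s => [|y t IH] s us ut /=.
  by case: s {us} => // _; exists (fun=> t0).
case/andP: ut => yt ut [/(IH s us ut) [k [kinj kP]]|].
  by exists k; split=> // x /kP [kt kR]; rewrite inE kt orbT.
case: s us => [|x s] /=; first by exists (fun=> t0).
case/andP=> xs us [Rxy /(IH s us ut) [k [kinj kP]]].
have xneq z : z \in s -> (z == x) = false.
  by move=> zs; apply: contraNF xs => /eqP <-.
have yneq z : z \in s -> k z <> y.
  by move=> /kP [kt _] e; rewrite -e kt in yt.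
exists (fun z => if z == x then y else k z); split=> [z w|z].
  rewrite !inE => /predU1P[->|zs] /predU1P[->|ws] //; rewrite ?eqxx.
  - by rewrite xneq // => /esym /yneq; case.
  - by rewrite xneq // => /yneq; case.
  - by rewrite !xneq //; apply: kinj.
rewrite inE => /predU1P[->|zs]; first by rewrite eqxx mem_head.
by have [kt kR] := kP z zs; rewrite xneq // inE kt orbT.
Qed.

(** The hypothesis gives an injection [k] on the centres of the sub-balls of radius [d] and an
    embedding of each sub-ball. These glue together, because points of distinct sub-balls are at
    distance exactly [d + 1] on both sides. *)
Lemma ball_emb_step d s t :
  subseq_emb (ball_emb d) (map (recenter (s := s)) (ball_reps d s))
    (map (recenter (s := t)) (ball_reps d t)) ->
  ball_emb d.+1 s t.
Proof.
have reps_uniq u : uniq (ball_reps d u) by rewrite filter_uniq ?enum_uniq.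
move=> /(subseq_emb_map (us_pt t) (reps_uniq s) (reps_uniq t)) [k [kinj kP]].
have hs := us_um s; have ht := us_um t.
pose r := urep (@us_h s) d.
have rP x : us_h (us_pt s) x <= d.+1 -> r x \in ball_reps d s.
  move=> xs; rewrite mem_filter mem_enum andbT (urep_id hs) // eqxx andbT.
  by rewrite -(um_ler hs _ (leqW (urep_le hs d x))).
have [F FP] : exists F : us_V s -> us_V s -> us_V t, forall x,
    x \in ball_reps d s -> forall y, us_h x y <= d ->
    [/\ us_h (k x) (F x y) <= d, us_col (F x y) = us_col y
      & forall z, us_h x z <= d -> us_h (F x y) (F x z) = us_h y z].
  have /fin_all_exists // : forall x, exists f, x \in ball_reps d s ->
      forall y, us_h x y <= d -> [/\ us_h (k x) (f y) <= d,
        us_col (f y) = us_col y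
        & forall z, us_h x z <= d -> us_h (f y) (f z) = us_h y z].
  move=> x; have [xs|_] := boolP (x \in ball_reps d s); last first.
    by exists (fun=> us_pt t).
  by have [_ [f fP]] := kP x xs; exists f.
have rle x : us_h (r x) x <= d by rewrite (um_sym hs) urep_le.
exists (fun x => F (r x) x) => x xs.
have [Fx Fc Fh] := FP _ (rP x xs) x (rle x).
have kball z : us_h (us_pt s) z <= d.+1 ->
    us_h (us_pt t) (k (r z)) <= d.+1 /\ urep (@us_h t) d (k (r z)) = k (r z).
  move=> zs; have [] := kP _ (rP z zs).
  by rewrite mem_filter => /andP[/andP[-> /eqP]].
have [bx ux] := kball x xs.
have Fball : us_h (us_pt t) (F (r x) x) <= d.+1.
  by rewrite -(um_ler ht _ (leqW Fx)).
split=> // y ys; have [by_ uy] := kball y ys.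
have [Fy _ _] := FP _ (rP y ys) y (rle y).
have [e|ne] := eqVneq (r x) (r y).
  by rewrite -e Fh // e; apply: rle.
have -> : us_h x y = d.+1.
  apply/eqP; rewrite eqn_leq -(um_lel hs _ xs) ys /=.
  by rewrite ltnNge -(urep_eq hs).
(* The images lie in the sub-balls centred at [k (r x)] and [k (r y)], which are distinct
   representatives, so they are more than [d] apart. *)
apply/eqP; rewrite eqn_leq -(um_lel ht _ Fball) -(um_ler ht _ (leqW Fy)) by_ /=.
rewrite ltnNge -(um_lel ht _ Fx) -(um_ler ht _ Fy) -(urep_eq ht) ux uy.
by apply: contra ne => /eqP /kinj -> //; apply: rP.
Qed.

Lemma ball_emb_wqo d : wqo (ball_emb d).
Proof.
elim: d => [|d IH] f.
  (* A ball of radius 0 is a single coloured point. *)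
  have [i [j [ij e]]] := wqo_finType_eq (fun n => us_col (us_pt (f n))).
  exists i, j; split=> //; exists (fun=> us_pt (f j)) => x.
  rewrite (um_le0 (us_um _)) => /eqP <-.
  split=> [|//|y]; first by rewrite (um_refl (us_um _)).
  by rewrite (um_le0 (us_um _)) => /eqP <-; rewrite !um_refl //; apply: us_um.
have [i [j [ij e]]] := higman (@ball_emb_trans d) IH
  (fun n => map (recenter (s := f n)) (ball_reps d (f n))).
by exists i, j; split=> //; apply: ball_emb_step.
Qed.
End UltraStructures.

(** * Graphs defined by a coloured ultrametric *)

Definition ultra_graph (d : nat) (C : finType) (P : nat -> C -> C -> bool)
    (G : graph) : Prop :=
  exists (h : G -> G -> nat) (col : G -> C),
    [/\ ultrametric h, forall x y, h x y <= d
      & forall x y, x != y -> adj x y = P (h x y) (col x) (col y)].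

Lemma ultra_graph_hereditary d (C : finType) (P : nat -> C -> C -> bool) G H :
  ultra_graph d P G -> has_induced G H -> ultra_graph d P H.
Proof.
move=> [h [col [[h0 hs ht] hd hP]]] /has_inducedP [f [finj fadj]].
exists (fun x y => h (f x) (f y)), (fun x => col (f x)); split=> //.
  by split=> *; [rewrite h0 (inj_eq finj) | apply: hs | apply: ht; eauto].
by move=> x y xy; rewrite -fadj hP // (inj_eq finj).
Qed.

Lemma ultra_graph_good d (C : finType) (P : nat -> C -> C -> bool)
    (f : nat -> graph) :
  (forall n, ultra_graph d P (f n)) ->
  exists i j, i < j /\ has_induced (f j) (f i).
Proof.
move=> fU.
(* The vertices of [s] are tied to those of [f n] by a bijection rather than an equality of types.
   All distances are at most [d], so the ball of radius [d] is everything. *)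
have next n : exists s : ustruct C, exists (a : f n -> us_V s) (b : us_V s -> f n),
   [/\ cancel a b, cancel b a, forall x y : us_V s, us_h x y <= d
     & forall x y, x != y -> adj x y = P (us_h (a x) (a y)) (us_col (a x)) (us_col (a y))].
  have [h [col [hU hd hP]]] := fU n.
  have /card_gt0P [x _] := vertex_gt0 (f n).
  by exists (UStruct col hU x), id, id.
have [s sP] := functional_choice _ next.
have [i [j [ij [g gP]]]] := @ball_emb_wqo C d s.
exists i, j; split=> //; apply/has_inducedP.
have [a [b [aK bK hd aP]]] := sP i; have [a' [b' [aK' bK' hd' aP']]] := sP j.
have gh x y : us_h (g x) (g y) = us_h x y by have [_ _ ->] := gP x (hd _ _).
have gc x : us_col (g x) = us_col x by have [_ -> _] := gP x (hd _ _).
have ginj : injective g.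
  move=> x y e; apply/eqP; rewrite -(um_eq0 (us_um _)) -gh e.
  by rewrite (um_refl (us_um _)).
have inj : injective (fun x => b' (g (a x))).
  by move=> x y /(can_inj bK') /ginj /(can_inj aK).
exists (fun x => b' (g (a x))); split=> // x y.
have [<-|xy] := eqVneq x y; first by rewrite !adj_irrefl.
by rewrite aP' ?(inj_eq inj) // !bK' gh !gc -aP.
Qed.

(** Otherwise every finite list of members of [Q] is avoided by a further member, and iteration
    gives a sequence in which no term contains an earlier one. *)
Lemma finite_basis (Q : graph -> Prop) :
  (forall f : nat -> graph, (forall n, Q (f n)) ->
     exists i j, i < j /\ has_induced (f j) (f i)) ->
  exists s : seq graph, (forall i, i < size s -> Q (nth K1 s i)) /\
    forall G, Q G -> exists2 i, i < size s & has_induced G (nth K1 s i).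
Proof.
move=> good; apply: NNPP => nob.
pose all_Q (s : seq graph) := forall i, i < size s -> Q (nth K1 s i).
have next (s : seq graph) : exists G, all_Q s -> Q G /\
    forall i, i < size s -> ~ has_induced G (nth K1 s i).
  apply: NNPP => noG; apply: nob; exists s; split=> [|G QG].
    by apply: NNPP => nq; apply: noG; exists K1.
  apply: NNPP => noi; apply: noG; exists G => _; split=> // i lt hi.
  by apply: noi; exists i.
have [c cP] := functional_choice _ next.
(* [L n] lists the first [n] choices, the [i]-th of which avoids all of [L i]. *)
pose L n := iter n (fun s => rcons s (c s)) [::].
have sL n : size (L n) = n by elim: n => //= n IH; rewrite size_rcons IH.
have nL n i : i < n -> nth K1 (L n) i = c (L i).
  elim: n => //= n IH; rewrite ltnS nth_rcons sL leq_eqVlt.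
  by case: ltngtP => //= [lt _|-> //]; rewrite IH.
have QL n : all_Q (L n).
  elim/ltn_ind: n => n IH i; rewrite sL => lt; rewrite nL //.
  by have [] := cP _ (IH i lt).
have Qc n : Q (c (L n)) by have [] := cP _ (QL n).
have [i [j [ij]]] := good (fun n => c (L n)) Qc.
rewrite -(nL j i ij); have [_] := cP _ (QL j).
by apply; rewrite sL.
Qed.

(** * One-vertex extensions and finite obstruction sets *)

Section AddVertex.
Variables (d : nat) (C : finType) (P : nat -> C -> C -> bool).

(* The colour [None] is reserved for the new vertex [v]; the bit of an old
   vertex records whether it is adjacent to [v]. *)
Definition add_vertex_rel (i : nat) (a b : option (bool * C)) : bool :=
  match a, b with
  | Some (_, c), Some (_, c') => P i c c'
  | Some (e, _), None => e
  | None, Some (e, _) => e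
  | None, None => false
  end.

Lemma ultra_graph_add_vertex (G : graph) (v : G) :
  (forall X_gt0 : 0 < #|[set~ v]|, ultra_graph d P (induced X_gt0)) ->
  ultra_graph d.+1 add_vertex_rel G.
Proof.
(* Graphs are nonempty, so nothing can be deleted when [v] is the only vertex. *)
move=> GvU; case: (eqVneq #|[set~ v]| 0) => [X0|].
  have all_v x : x = v.
    apply/eqP; apply: contraT => xv; have /card0_eq /(_ x) := X0.
    by rewrite !inE xv.
  exists (fun _ _ => 0), (fun=> None); split=> // [|x y].
    by split=> // x y; rewrite (all_v x) (all_v y) !eqxx.
  by rewrite (all_v x) (all_v y) eqxx.
rewrite -lt0n => X_gt0; have [h [col [hU hd hP]]] := GvU X_gt0.
pose p (x : G) : option (induced X_gt0) := insub x.
have pv : p v = None by rewrite /p insubF // !inE eqxx.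
have pS x : x != v -> exists2 y, p x = Some y & val y = x.
  by move=> xv; rewrite /p; case: insubP => [y _ <-|]; [exists y | rewrite !inE xv].
pose h' x y := match p x, p y with
  | Some x', Some y' => h x' y' | None, None => 0 | _, _ => d.+1 end.
pose col' x := if p x is Some x' then Some (adj v x, col x') else None.
have pinj x y : p x = p y -> x = y.
  have [->|/pS[x' -> <-]] := eqVneq x v; have [->|/pS[y' -> <-]] := eqVneq y v => //.
  - by rewrite pv.
  - by rewrite pv.
  - by case=> ->.
exists h', col'; split=> [|x y|x y xy].
- split=> [x y|x y|i x y z]; rewrite /h'.
  + rewrite -(inj_eq pinj); case: (p x) (p y) => [x'|] [y'|] //.
    by rewrite (um_eq0 hU).
  + by case: (p x) (p y) => [x'|] [y'|] //; rewrite (um_sym hU).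
  + case: (p x) (p y) (p z) => [x'|] [y'|] [z'|] //; first exact: (um_trans hU).
    by move=> di _; apply: leq_trans (hd _ _) (ltnW di).
- by rewrite /h'; case: (p x) (p y) => [x'|] [y'|] //; rewrite ltnW // ltnS.
rewrite /h' /col'; have [e|/pS[x' px e]] := eqVneq x v.
  rewrite e pv; have [e'|/pS[y' -> _] //] := eqVneq y v.
  by rewrite e e' eqxx in xy.
rewrite px; have [->|/pS[y' -> e']] := eqVneq y v; first by rewrite pv adj_sym.
have := hP x' y'; rewrite /= /induced_rel e e' => <- //.
by apply: contraNneq xy => exy; rewrite -e -e' exy.
Qed.
End AddVertex.

(** The obstructions are a finite basis of [Q], the graphs outside [K] that lie in the one-vertex
    extension family; minimality of an obstruction is never mentioned. *)
Theorem finite_obstructions (d : nat) (C : finType) (P : nat -> C -> C -> bool)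
    (K : graph -> Prop) :
  (forall G H, K G -> has_induced G H -> K H) ->
  (forall G, K G -> ultra_graph d P G) ->
  exists (k : nat) (F : 'I_k -> graph),
    forall G, K G <-> ~ exists i : 'I_k, has_induced G (F i).
Proof.
move=> Khered KU.
pose Q G := ~ K G /\ ultra_graph d.+1 (add_vertex_rel P) G.
(* If [G] is outside the extension family, then deleting any vertex [v] leaves a graph still outside
   [K], and induction on the number of vertices applies. *)
have reach G : ~ K G -> exists2 H, Q H & has_induced G H.
  move: {2}#|G| (erefl #|G|) => n; elim/ltn_ind: n G => n IH G Gn nK.
  have [U|noU] := classic (ultra_graph d.+1 (add_vertex_rel P) G).
    by exists G; [split | apply: has_induced_refl].
  have /card_gt0P [v _] := vertex_gt0 G.
  have [X_gt0 nKv] : exists X_gt0 : 0 < #|[set~ v]|, ~ K (induced X_gt0).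
    apply: NNPP => no; apply: noU; apply: (ultra_graph_add_vertex (v := v)) => X_gt0.
    by apply: KU; apply: NNPP => nK'; apply: no; exists X_gt0.
  have ind : has_induced G (induced X_gt0).
    by exists [set~ v], X_gt0; exists id; split=> //; exists id.
  have [|H QH GH] := IH #|induced X_gt0| _ (induced X_gt0) (erefl _) nKv.
    by rewrite card_sig cardsC1 -Gn ltn_predL vertex_gt0.
  by exists H => //; apply: has_induced_trans GH.
have [f fQ|s [sQ sB]] := @finite_basis Q.
  by apply: (@ultra_graph_good d.+1 _ (add_vertex_rel P)) => n; case: (fQ n).
exists (size s), (fun i => nth K1 s i) => G; split=> [KG [i Gi]|no].
  by have [nK _] := sQ i (ltn_ord i); apply: nK; apply: Khered Gi.
apply: NNPP => /reach [H /sB [i lt Hi] GH]; apply: no.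
by exists (Ordinal lt); apply: has_induced_trans Hi.
Qed.

(** * Tree-models *)

Definition walk (G : graph) (x y : G) (k : nat) : Prop :=
  exists p : seq G, [/\ path (@adj G) x p, last x p = y & size p = k].

Lemma walk_cat (G : graph) (x y z : G) k l :
  walk x y k -> walk y z l -> walk x z (k + l).
Proof.
move=> [p [px <- <-]] [q [qy <- <-]]; exists (p ++ q).
by rewrite cat_path px qy last_cat size_cat.
Qed.

Lemma walk_sym (G : graph) (x y : G) k : walk x y k -> walk y x k.
Proof.
move=> [p [px <- <-]]; exists (rev (belast x p)).
rewrite rev_path size_rev size_belast (@eq_path _ _ (@adj G)) => [|u v].
  by split=> //; case: p {px} => //= a p; rewrite rev_cons last_rcons.
by rewrite adj_sym.
Qed.

Lemma is_dist_unique (G : graph) (x y : G) k l :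
  is_dist x y k -> is_dist x y l -> k = l.
Proof.
move=> [[p [p1 p2 p3]] pm] [[q [q1 q2 q3]] qm]; apply/eqP.
by rewrite eqn_leq -{1}q3 -{2}p3 pm ?qm.
Qed.


Lemma is_dist_exists (G : graph) (x y : G) k :
  walk x y k -> exists l, is_dist x y l.
Proof.
elim/ltn_ind: k => k IH w.
have [[l [lk /(IH l lk)]] //|no] := classic (exists l, l < k /\ walk x y l).
exists k; split=> // p px py; rewrite leqNgt; apply/negP => lt.
by apply: no; exists (size p); split=> //; exists p.
Qed.

(** * Trees presented by a parent map and a depth function *)

Section ParentTree.
Variables (T : graph) (r : T) (par : T -> T) (dep : T -> nat).
Hypothesis dep_r : dep r = 0.
Hypothesis dep0 : forall x, dep x = 0 -> x = r.
Hypothesis dep_par : forall x, dep (par x) = (dep x).-1.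
Hypothesis adj_par : forall x, x != r -> adj x (par x).
Hypothesis par_adj : forall x y : T, adj x y -> par x = y \/ par y = x.

Lemma par_root : par r = r.
Proof. by apply: dep0; rewrite dep_par dep_r. Qed.

Lemma dep_anc i x : dep (iter i par x) = dep x - i.
Proof. by elim: i => [|i IH]; rewrite ?subn0 //= dep_par IH subnS. Qed.

Lemma anc_root i x : dep x <= i -> iter i par x = r.
Proof. by move=> le; apply: dep0; rewrite dep_anc; apply/eqP. Qed.

Lemma dep_gt0 x : x != r -> 0 < dep x.
Proof. by move=> xr; rewrite lt0n; apply: contraNneq xr => /dep0 ->. Qed.

Lemma par_child x y : adj x y -> par y = x -> dep y = (dep x).+1.
Proof.
move=> xy yx; rewrite -yx dep_par prednK // dep_gt0 //.
by apply: contraTneq xy => yr; rewrite -yx yr par_root adj_irrefl.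
Qed.

Lemma walk_anc i x : i <= dep x -> walk x (iter i par x) i.
Proof.
elim: i => [|i IH] le; first by exists [::].
rewrite -[X in walk _ _ X]addn1; apply: walk_cat (IH (ltnW le)) _.
exists [:: iter i.+1 par x]; split=> //; rewrite /= andbT adj_par //.
by apply: contraTneq le => e; rewrite -leqNgt -subn_eq0 -dep_anc e dep_r.
Qed.

(** Each edge goes to or from a parent, so induction along the walk bounds the total climb to a
    common ancestor. The lower bounds on distances rest on this. *)
Lemma walk_meet x y k : walk x y k ->
  exists i j, i + j <= k /\ iter i par x = iter j par y.
Proof.
move=> [p [px <- <-]]; elim: p x px => [|z p IH] x /=; first by exists 0, 0.
case/andP=> xz /IH [i [j [le e]]]; case: (par_adj xz) => [xE|zE].
  by exists i.+1, j; split=> //; rewrite iterSr xE.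
case: i le e => [|i] le e.
  by exists 0, j.+1; split=> //=; rewrite -e.
exists i, j; split; first by rewrite ltnW // ltnW.
by rewrite -e iterSr zE.
Qed.

Lemma dist_root x : is_dist r x (dep x).
Proof.
split=> [|p px py].
  by apply: walk_sym; rewrite -[X in walk _ X](@anc_root (dep x) x) //; apply: walk_anc.
have [i [j [le]]] : exists i j, i + j <= size p /\ iter i par r = iter j par x.
  by apply: walk_meet; exists p.
rewrite anc_root ?dep_r // => /(congr1 dep); rewrite dep_r dep_anc => /esym/eqP.
by rewrite subn_eq0 => /leq_trans; apply; apply: leq_trans le; apply: leq_addl.
Qed.

(** The root is its own parent, hence [y = r] instead of absurdity; this covers a tree reduced to
    its root. *)
Lemma leafE x : leaf r x <-> forall y, par y = x -> y = r.
Proof.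
split=> [lx y yx|noc [y [xy [k [dx dy]]]]].
  apply/eqP; apply: contraT => yr; case: lx; exists y.
  have xy : adj x y by rewrite adj_sym -yx adj_par.
  split=> //; exists (dep x); split; first exact: dist_root.
  by rewrite -(par_child xy yx); apply: dist_root.
have ek := is_dist_unique dx (dist_root x).
have ek1 := is_dist_unique dy (dist_root y).
case: (par_adj xy) => [xE|/noc yr]; last by rewrite yr dep_r in ek1.
by move: ek1; rewrite -xE dep_par -ek; case: (k) => // n /eqP; rewrite eqn_leq ltnNge leqnSn.
Qed.

Lemma dist_meet x y h : dep x = dep y -> iter h par x = iter h par y ->
  (forall i, iter i par x = iter i par y -> h <= i) -> is_dist x y (2 * h).
Proof.
move=> dxy hxy hmin.
have hle : h <= dep x by apply: hmin; rewrite !anc_root // dxy.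
rewrite mul2n -addnn; split=> [|p px py].
  apply: walk_cat (walk_anc hle) _; rewrite hxy.
  by apply: walk_sym; apply: walk_anc; rewrite -dxy.
have [i [j [le e]]] : exists i j, i + j <= size p /\ iter i par x = iter j par y.
  by apply: walk_meet; exists p.
apply: leq_trans le.
have [eij|nij] := eqVneq i j; first by rewrite -eij in e *; rewrite leq_add ?hmin.
have := congr1 dep e; rewrite !dep_anc -dxy => eij.
(* Climbs of different lengths from equal depth can meet only at the root, so each has length at
   least [dep x]. *)
suff [hi hj] : dep x <= i /\ dep x <= j by rewrite leq_add // (leq_trans hle).
case: (leqP (dep x) i) eij => [le eij|lt eij].
  by split=> //; rewrite -subn_eq0 -eij subn_eq0.
case: (leqP (dep x) j) eij => [le /eqP|lt' /eqP eij].
  by rewrite [X in _ == X](eqP le) subn_eq0 leqNgt lt.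
by move: nij; rewrite -(eqn_add2l (dep x - i)) subnK 1?ltnW // (eqP eij) subnK ?eqxx // ltnW.
Qed.

(** A simple path that goes down can never turn up again: the parent of the current vertex has just
    been visited. *)
Lemma uniq_path_dep x p : path (@adj T) x p -> uniq (x :: p) ->
  par x \notin p -> dep (last x p) = dep x + size p.
Proof.
elim: p x => [|y p IH] x; first by rewrite addn0.
rewrite [path _ _ _]/= => /andP[xy yp] /andP[xyp uyp].
rewrite inE negb_or => /andP[xNy _].
have yE : par y = x by case: (par_adj xy) => // e; rewrite e eqxx in xNy.
rewrite /= IH // ?(par_child xy yE) ?addSnnS // yE.
by move: xyp; rewrite inE negb_or => /andP[].
Qed.

Lemma uniq_path_dep_root p : path (@adj T) r p -> uniq (r :: p) ->
  dep (last r p) = size p.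
Proof.
move=> rp up; rewrite uniq_path_dep // ?dep_r // par_root.
by case/andP: up.
Qed.

Lemma parent_tree : is_tree T.
Proof.
split=> [x y|c /andP[cc uc]].
  have conn z : connect (@adj T) z r.
    have [p [zp zr _]] := walk_anc (leqnn (dep z)).
    by apply/connectP; exists p; rewrite // zr anc_root.
  apply: connect_trans (conn x) _.
  by rewrite (sym_connect_sym (@adj_sym T)).
(* On a cycle, both neighbours of a deepest vertex must be its parent; with three or more vertices
   they are distinct. *)
rewrite leqNgt; apply/negP => c3.
have [x0 x0c] : exists x, x \in c by case: (c) c3 => // x s; exists x; rewrite mem_head.
case: (arg_maxnP dep x0c) => x xc xmax.
have [i p ep] := rot_to xc.
have memp z : z \in p -> dep z <= dep x.
  by move=> zp; apply: xmax; have := mem_rot i c z; rewrite ep inE zp orbT.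
have up z : adj x z -> z \in p -> par x = z.
  move=> xz /memp zx; case: (par_adj xz) => // /(par_child xz) e.
  by rewrite e ltnn in zx.
move: cc uc c3; rewrite -(rot_cycle i) -(rot_uniq i) -(size_rot i) ep /=.
case: p {ep memp} up => [|y p] //; case/lastP: p => [|p z] // up.
rewrite rcons_path /= last_rcons => /andP[/andP[xy _] zx] /and3P[_ yp _] _.
move/negP: yp; apply; rewrite -(up y xy) ?mem_head //.
have zp : z \in rcons p z by rewrite mem_rcons mem_head.
by rewrite (up z) // 1?adj_sym // inE zp orbT.
Qed.
End ParentTree.

(** * Parent map and depth of an arbitrary rooted tree *)

Section TreeParent.
Variables (T : graph) (r : T).
Hypothesis treeT : is_tree T.

(** Depth is the distance from the root, and the parent is the last but one vertex of a shortest
    path from it. Acyclicity is what forces every edge to join a vertex to its parent. *)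
Lemma tree_parent : exists (par : T -> T) (dep : T -> nat),
  [/\ dep r = 0, forall x, dep x = 0 -> x = r,
      forall x, dep (par x) = (dep x).-1,
      forall x, x != r -> adj x (par x)
    & forall x y : T, adj x y -> par x = y \/ par y = x].
Proof.
have [conn acyc] := treeT.
have [dep depP] : exists dep : T -> nat, forall x, is_dist r x (dep x).
  have /fin_all_exists // : forall x, exists k, is_dist r x k.
  move=> x; have /connectP [p rp ->] := conn r x.
  by apply: (@is_dist_exists _ _ _ (size p)); exists p.
have dep_r : dep r = 0.
  by apply/eqP; rewrite -leqn0; have [_ /(_ [::])] := depP r; apply.
have dep0 x : dep x = 0 -> x = r.
  by move=> dx; have [[p [_ px sp]] _] := depP x; rewrite dx in sp; rewrite -px (size0nil sp).
have depS x y : adj x y -> dep y <= (dep x).+1.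
  move=> xy; have [[p [rp px <-]] _] := depP x; have [_ ymin] := depP y.
  have := ymin (rcons p y); rewrite rcons_path rp px xy last_rcons size_rcons.
  exact.
have [par parP] : exists par : T -> T, forall x,
    if x == r then par x = r else adj x (par x) /\ dep x = (dep (par x)).+1.
  have /fin_all_exists // : forall x, exists y,
    if x == r then y = r else adj x y /\ dep x = (dep y).+1.
  move=> x; have [xr|xr] := eqVneq x r; first by exists r.
  have [[p [rp px sp]] _] := depP x.
  case/lastP: p rp px sp => [_ /= e|p z]; first by rewrite e eqxx in xr.
  rewrite rcons_path last_rcons size_rcons => /andP[rp yx] zx sp.
  rewrite {z}zx in yx; exists (last r p); split; first by rewrite adj_sym.
  apply/eqP; rewrite eqn_leq depS //= -sp ltnS.
  by have [_] := depP (last r p); apply.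
have adj_par x : x != r -> adj x (par x).
  by move=> xr; have := parP x; rewrite (negPf xr) => -[].
have dep_par x : dep (par x) = (dep x).-1.
  by have := parP x; case: eqP => [->-> |_ [_ ->] //]; rewrite dep_r.
have dep_gt0 x : x != r -> 0 < dep x.
  by move=> xr; rewrite lt0n; apply: contraNneq xr => /dep0 ->.
(* The vertices of depth at most [k] are connected through the root, by paths that avoid all deeper
   vertices. *)
pose low k := [rel x y : T | [&& adj x y, dep x <= k & dep y <= k]].
have low_sym k : connect_sym (low k).
  by apply: sym_connect_sym => x y /=; rewrite adj_sym andbC andbAC -andbA andbC andbA.
have low_root k x : dep x <= k -> connect (low k) x r.
  elim: {x}(dep x) {-2}x (erefl (dep x)) => [|n IH] x dx lek.
    by rewrite (dep0 x dx).
  have xr : x != r by apply: contra_eqN dx => /eqP ->; rewrite dep_r.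
  have dp : dep (par x) = n by rewrite dep_par dx.
  have dpk : dep (par x) <= k by apply: leq_trans lek; rewrite dp dx.
  apply: connect_trans (IH _ dp dpk); apply: connect1.
  by rewrite /= adj_par // lek.
have low_path k x y : dep x <= k -> dep y <= k -> exists p : seq T,
    [/\ path (@adj T) x p, last x p = y, uniq (x :: p)
      & forall z, z \in x :: p -> dep z <= k].
  move=> xk yk.
  have /connectP [p0 p0P ->] : connect (low k) x y.
    by apply: connect_trans (low_root _ _ xk) _; rewrite low_sym low_root.
  case/shortenP: p0P => p lp up _; exists p; split=> //.
    by apply: sub_path lp => u v /and3P[].
  move=> z; rewrite inE => /predU1P[-> //|].
  elim: p {up} x {xk} lp => // u p IH x /= /andP[/and3P[_ _ uk] lp].
  by rewrite inE => /predU1P[->//|]; apply: IH lp.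
exists par, dep; split=> //.
(* With a second shallower neighbour [y], a path from [par x] to [y] above [x] would close up
   through [x] to a cycle. *)
have up x y : adj x y -> dep y < dep x -> par x = y.
  move=> xy yx; apply: NNPP => /eqP ne.
  have xr : x != r by apply: contraTneq yx => ->; rewrite dep_r.
  have [||p [pp pl pu pd]] := @low_path (dep x).-1 (par x) y.
    by rewrite dep_par.
    by rewrite -ltnS prednK ?dep_gt0.
  have := acyc (x :: par x :: p).
  case: p pp pl pu pd => [_ /= e|u p pp pl pu pd]; first by rewrite e eqxx in ne.
  suff H : ucycle (@adj T) (x :: par x :: u :: p) by move/(_ H).
  rewrite /ucycle /= in pp *; rewrite adj_par //=.
  rewrite rcons_path; case/andP: pp => -> -> /=.
  move: pl => /= ->; rewrite adj_sym xy /=.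
  move: pu => /= ->; rewrite andbT; apply/negP => /pd.
  by rewrite leqNgt prednK ?dep_gt0 ?leqnn.
move=> x y xy; case: (ltngtP (dep x) (dep y)) => [lt|lt|eq].
- by right; apply: up; rewrite // adj_sym.
- by left; apply: up.
(* For adjacent [x] and [y] of equal depth, a path joining their parents closes up through [x] and
   [y] to a cycle. *)
exfalso.
have xr : x != r.
  apply: contraTneq (xy) => e; have /dep0 -> : dep y = 0 by rewrite -eq e.
  by rewrite e adj_irrefl.
have yr : y != r.
  apply: contraTneq (xy) => e; have /dep0 -> : dep x = 0 by rewrite eq e.
  by rewrite e adj_irrefl.
have [||p [pp pl pu pd]] := @low_path (dep x).-1 (par x) (par y).
  by rewrite dep_par.
  by rewrite dep_par eq.
have := acyc (y :: x :: par x :: p).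
suff H : ucycle (@adj T) (y :: x :: par x :: p) by move/(_ H).
have notp z : dep z = dep x -> z \notin par x :: p.
  move=> dz; apply/negP => /pd; rewrite dz leqNgt prednK ?dep_gt0 ?leqnn //.
apply/andP; split; last first.
  rewrite 2!cons_uniq pu notp // andbT inE negb_or notp // andbT.
  by rewrite andbT; apply: contraTneq xy => ->; rewrite adj_irrefl.
rewrite /= adj_sym xy adj_par //= rcons_path pp pl /= adj_sym adj_par //.
Qed.
End TreeParent.

(** Reads [S] at a level given as a natural number, with value false outside [1..d]. *)
Definition tm_rel (d m : nat) (S : {set 'I_m * 'I_m * 'I_d}) (i : nat)
    (a b : 'I_m) : bool :=
  [exists l : 'I_d, (i == l.+1) && ((a, b, l) \in S)].

Lemma tm_relE d m (S : {set 'I_m * 'I_m * 'I_d}) (l : 'I_d) a b :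
  tm_rel S l.+1 a b = ((a, b, l) \in S).
Proof.
apply/existsP/idP => [[l' /andP[/eqP[/ord_inj ->]]]|abl] //.
by exists l; rewrite eqxx.
Qed.

(** [h u v] counts the climbs until the ancestors of the two leaves agree. All leaves have depth
    [d], so [d] climbs suffice, and ancestors that agree once agree from then on. *)
Lemma tree_model_ultra d m (G T : graph) (r : T) (nu : G -> T)
    (col : G -> 'I_m) (S : {set 'I_m * 'I_m * 'I_d}) :
  tree_model r nu col S -> ultra_graph d (tm_rel S) G.
Proof.
move=> [treeT depth nu_inj leaves Ssym nu_adj].
have [par [dep [dep_r dep0 dep_par adj_par par_adj]]] := tree_parent r treeT.
have dep_nu v : dep (nu v) = d.
  have /connectP [p0 /shortenP [p rp up _] vE] := (proj1 treeT) r (nu v).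
  rewrite vE (uniq_path_dep_root dep_r dep0 dep_par par_adj) //.
  by apply: depth => //; rewrite -vE; apply/leaves; exists v.
have ex u v : exists i, iter i par (nu u) == iter i par (nu v).
  by exists d; rewrite !(anc_root dep0 dep_par) ?dep_nu.
pose h u v := ex_minn (ex u v).
have hP u v i : (h u v <= i) = (iter i par (nu u) == iter i par (nu v)).
  rewrite /h; case: ex_minnP => k /eqP ek kmin; apply/idP/idP; last exact: kmin.
  by move=> /subnK <-; rewrite !iterD ek.
have h_le u v : h u v <= d by rewrite hP !(anc_root dep0 dep_par) ?dep_nu.
have hU : ultrametric h.
  split=> [u v|u v|i u v w].
  - by rewrite -leqn0 hP /= (inj_eq nu_inj).
  - by apply/eqP; rewrite eqn_leq hP eq_sym -hP leqnn hP eq_sym -hP leqnn.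
  - by rewrite !hP => /eqP ->.
exists h, col; split=> // u v uv.
have h_gt0 : 0 < h u v by rewrite lt0n (um_eq0 hU).
have lt : (h u v).-1 < d by rewrite prednK.
have hE : h u v = (Ordinal lt).+1 by rewrite /= prednK.
rewrite [in RHS]hE tm_relE; apply: nu_adj => //.
rewrite -hE; apply: (dist_meet dep_r dep0 dep_par adj_par par_adj).
- by rewrite !dep_nu.
- by apply/eqP; rewrite -hP.
- by move=> i /eqP; rewrite -hP.
Qed.

(** * The tree of balls of an ultrametric *)

Section BallTree.
Variables (d : nat) (G : graph) (h : G -> G -> nat).
Hypotheses (hU : ultrametric h) (h_le : forall x y, h x y <= d).

(* The node [(i, x)] is the closed ball of radius [i] whose canonical
   representative is [x]; its parent is the ball of radius [i + 1]. *)
Definition bnode := {p : 'I_d.+1 * G | urep h p.1 p.2 == p.2}.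

Lemma bnode_subproof (i : 'I_d.+1) x : urep h i (urep h i x) == urep h i x.
Proof. by rewrite (urep_id hU). Qed.

Definition bmk (i : 'I_d.+1) (x : G) : bnode :=
  exist _ (i, urep h i x) (bnode_subproof i x).

(** Capping the radius at [d] makes the root its own parent. *)
Definition bpar (t : bnode) : bnode :=
  bmk (inord (minn (val t).1.+1 d)) (val t).2.

Definition bdep (t : bnode) : nat := d - (val t).1.

Definition badj : rel bnode :=
  fun s t => (s != t) && ((bpar s == t) || (bpar t == s)).

Lemma badj_sym : symmetric badj.
Proof. by move=> s t; rewrite /badj eq_sym orbC. Qed.

Lemma badj_irrefl : irreflexive badj.
Proof. by move=> s; rewrite /badj eqxx. Qed.

Lemma bnode_gt0 : 0 < #|{: bnode}|.
Proof.
have /card_gt0P [x _] := vertex_gt0 G.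
by apply/card_gt0P; exists (bmk ord0 x).
Qed.

Definition ball_tree : graph := Graph badj_sym badj_irrefl bnode_gt0.

Lemma bmk_eq (i : 'I_d.+1) x y : (bmk i x == bmk i y) = (h x y <= i).
Proof. by rewrite -val_eqE /= xpair_eqE eqxx (urep_eq hU). Qed.

Lemma bnodeE (t : bnode) : t = bmk (val t).1 (val t).2.
Proof. by case: t => [[i x] /= ix]; apply: val_inj; rewrite /= (eqP ix). Qed.

Lemma bpar_mk (i : 'I_d.+1) x : bpar (bmk i x) = bmk (inord (minn i.+1 d)) x.
Proof.
rewrite /bpar /=; apply/eqP; rewrite bmk_eq inordK ?ltnS ?geq_minr //.
rewrite (um_sym hU) leq_min h_le andbT.
exact: leq_trans (urep_le hU _ _) _.
Qed.

(** A vertex becomes its ball of radius 0, whose [i]-th ancestor is the ball of radius [i]; two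
    leaves [x] and [y] therefore first meet after [h x y] climbs. *)
Lemma ultra_tree_model m (col : G -> 'I_m) (S : {set 'I_m * 'I_m * 'I_d}) :
  (forall i j l, ((i, j, l) \in S) = ((j, i, l) \in S)) ->
  (forall x y, x != y -> adj x y = tm_rel S (h x y) (col x) (col y)) ->
  TM d m G.
Proof.
move=> Ssym hS; have /card_gt0P [x0 _] := vertex_gt0 G.
pose r : ball_tree := bmk ord_max x0.
have dep_r : bdep r = 0 by rewrite /bdep /= subnn.
have dep0 (t : ball_tree) : bdep t = 0 -> t = r.
  rewrite [t]bnodeE /bdep /=; move: (val t).1 (val t).2 => i x /eqP id0.
  have -> : i = ord_max by apply: val_inj; apply/eqP; rewrite eqn_leq -ltnS ltn_ord.
  by apply/eqP; rewrite bmk_eq h_le.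
have dep_par (t : ball_tree) : bdep (bpar t) = (bdep t).-1.
  rewrite /bdep /= inordK ?ltnS ?geq_minr // -subnS.
  by case: leqP => [_ //|lt]; rewrite subnn; apply/esym/eqP; rewrite subn_eq0 ltnW.
have adj_par (t : ball_tree) : t != r -> adj t (bpar t).
  move=> tr; rewrite /= /badj eqxx andbT; apply: contraNneq tr => e.
  by rewrite [t]dep0 //; have := dep_par t; rewrite -e; case: (bdep t) => // n /eqP;
    rewrite /= eqn_leq ltnn.
have par_adj (s t : ball_tree) : adj s t -> bpar s = t \/ bpar t = s.
  by move=> /andP[_ /orP[] /eqP]; [left | right].
pose nu x : ball_tree := bmk ord0 x.
have dep_nu x : bdep (nu x) = d by rewrite /bdep subn0.
have nu_inj : injective nu.
  by move=> x y /eqP; rewrite bmk_eq (um_le0 hU) => /eqP.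
have anc_nu i x : i <= d -> iter i bpar (nu x) = bmk (inord i) x.
  elim: i => [_|i IH lt] /=; first by congr (bmk _ x); apply: val_inj; rewrite /= inordK.
  by rewrite IH ?(ltnW lt) // bpar_mk inordK ?(minn_idPl lt) // ltnS ltnW.
have leaves (t : ball_tree) : leaf (T := ball_tree) r t <-> exists v, nu v = t.
  rewrite (@leafE ball_tree r bpar bdep dep_r dep0 dep_par adj_par par_adj); split=> [noc|[v <-] s e].
    rewrite [t]bnodeE in noc *; move: (val t).1 (val t).2 noc => [[|i] lt] x noc.
      by exists x; congr (bmk _ x); apply: val_inj.
    (* A ball of positive radius has this child, whose radius is below [d], so it is not the
       root. *)
    pose s := bmk (Ordinal (ltnW lt)) x.
    have /(congr1 bdep) : s = r.
      apply: noc; rewrite bpar_mk /=; congr (bmk _ x); apply: val_inj.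
      by rewrite /= (minn_idPl _) // inordK.
    by rewrite dep_r /bdep /= => /eqP; rewrite subn_eq0 leqNgt -ltnS lt.
  apply: dep0; have := dep_par s; rewrite e dep_nu => ed.
  have : bdep s <= d by apply: leq_subr.
  by rewrite ed; case: (bdep s) => // n; rewrite ltnn.
exists ball_tree, r, nu, col, S; split=> //.
- exact: (@parent_tree ball_tree r bpar bdep) dep_r dep0 dep_par adj_par par_adj.
- move=> p rp up /leaves [v ve].
  by rewrite -(@uniq_path_dep_root ball_tree r bpar bdep dep_r dep0 dep_par par_adj p rp up) -ve.
- move=> u v l uv duv; rewrite hS //.
  have dh : is_dist (nu u) (nu v) (2 * h u v).
    apply: (@dist_meet ball_tree r bpar bdep dep_r dep0 dep_par adj_par par_adj); rewrite ?dep_nu //.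
      by rewrite !anc_nu //; apply/eqP; rewrite bmk_eq inordK // ltnS.
    move=> i; have [le|lt _] := leqP i d; last by apply: leq_trans (h_le u v) (ltnW lt).
    by rewrite !anc_nu // => /eqP; rewrite bmk_eq inordK.
  have /eqP := is_dist_unique dh duv; rewrite eqn_pmul2l // => /eqP ->.
  exact: tm_relE.
Qed.
End BallTree.

Theorem TM_ultraP d m (G : graph) :
  TM d m G <-> exists S : {set 'I_m * 'I_m * 'I_d},
    (forall i j l, ((i, j, l) \in S) = ((j, i, l) \in S)) /\
    ultra_graph d (tm_rel S) G.
Proof.
split=> [[T [r [nu [col [S tm]]]]]|[S [Ssym [h [col [hU h_le hS]]]]]].
  by exists S; split; [apply: tm_sym tm | apply: tree_model_ultra tm].
exact: ultra_tree_model Ssym hS.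
Qed.

Theorem TM_finite_obstructions d m : exists (k : nat) (F : 'I_k -> graph),
  forall G, TM d m G <-> ~ exists i : 'I_k, has_induced G (F i).
Proof.
(* Recording the signature [S] in every colour puts all tree-models under one
   adjacency rule. *)
pose P i (a b : {set 'I_m * 'I_m * 'I_d} * 'I_m) := tm_rel a.1 i a.2 b.2.
apply: (@finite_obstructions d _ P) => [G H /TM_ultraP [S [Ssym GS]] GH|G].
  by apply/TM_ultraP; exists S; split=> //; apply: ultra_graph_hereditary GH.
case/TM_ultraP=> S [_ [h [col [hU hd hP]]]].
by exists h, (fun x => (S, col x)).
Qed.

(** * Subset-complementation classes *)

(** As an exclusive or, complementing twice on the same set visibly cancels. *)
Lemma lcompl_adj (G : graph) (X : {set G}) (x y : G) : x != y ->
  @adj (lcompl X) x y = ((x \in X) && (y \in X)) (+) adj x y.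
Proof.
by move=> xy; rewrite /= /lcompl_rel xy /=; case: (_ && _).
Qed.

Lemma iso_has_induced (G H : graph) : iso G H -> has_induced H G.
Proof.
by move=> [f [fbij fadj]]; apply/has_inducedP; exists f; split=> //; apply: bij_inj.
Qed.

(* The bit of a colour at level [i] tells whether the vertex lies in the set
   that is complemented at level [i]; the sets of different components of that
   level are merged into one. *)
Fixpoint sc_col (n : nat) : finType :=
  if n is n'.+1 then (bool * sc_col n')%type else unit.

(** The test [i <= n'] says that both vertices lie in one component of the current union; only then
    do the inner levels contribute. *)
Fixpoint sc_rel (n : nat) : nat -> sc_col n -> sc_col n -> bool :=
  match n with
  | 0 => fun _ _ _ => false
  | n'.+1 => fun i a b => (a.1 && b.1) (+) ((i <= n') && sc_rel i a.2 b.2)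
  end.

(** Vertices of different components are put at distance [n + 1]. Inside a component distances are
    at most [n], so [h x y <= n] recognises the components. *)
Lemma SC_ultra n G : SC n G -> ultra_graph n (@sc_rel n) G.
Proof.
elim: n G => [|n IH] G /=.
  move=> /iso_has_induced; apply: ultra_graph_hereditary.
  exists (fun _ _ => 0), (fun=> tt); split=> [|//|[] []] //.
move=> [k [H [X [HSC /iso_has_induced]]]]; apply: ultra_graph_hereditary.
have [hh hhP] := fin_all_exists (fun i => IH (H i) (HSC i)).
have [cc ccP] := fin_all_exists hhP.
have hU i : ultrametric (hh i) by have [] := ccP i.
have h_le i x y : hh i x y <= n by have [_ /(_ x y)] := ccP i.
pose h (x y : dunion H) :=
  if tag x == tag y then hh (tag x) (tagged x) (tagged_as x y) else n.+1.
pose mk i (a : H i) : dunion H := Tagged (fun i => H i : Type) a.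
have hE i (a b : H i) : h (mk i a) (mk i b) = hh i a b.
  by rewrite /h /= eqxx tagged_asE.
have h_tag x y : (h x y <= n) = (tag x == tag y).
  by rewrite /h; case: eqP => _; rewrite ?h_le ?ltnn.
have h_leS x y : h x y <= n.+1.
  by rewrite /h; case: eqP => _ //; apply: leqW.
have hneq (x y : dunion H) : tag x != tag y -> h x y = n.+1.
  by rewrite /h => /negPf ->.
exists h, (fun x => (x \in X, cc (tag x) (tagged x))); split=> // [|x y xy].
  split=> [[i a] [j b]|[i a] [j b]|l [i a] [j b] [q c]].
  - have [e|ij] := eqVneq i j.
      by case: _ / e b => b; rewrite hE (um_eq0 (hU i)) -tag_eqE /tag_eq /= eqxx tagged_asE.
    by rewrite hneq // -tag_eqE /tag_eq /= (negPf ij).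
  - have [e|ij] := eqVneq i j.
      by case: _ / e b => b; rewrite !hE (um_sym (hU i)).
    by rewrite !hneq // eq_sym.
  - have [ln|nl] := ltnP n l; first by move=> _ _; apply: leq_trans (h_leS _ _) ln.
    move=> xy yz.
    have /eqP /= e : tag (mk i a) == tag (mk j b).
      by rewrite -h_tag (leq_trans xy).
    have /eqP /= e' : tag (mk j b) == tag (mk q c).
      by rewrite -h_tag (leq_trans yz).
    subst q; subst j; move: xy yz; rewrite !hE; exact: (um_trans (hU i)).
rewrite lcompl_adj //=; congr (_ (+) _); rewrite h_tag.
case: x y xy => [i a] [j b]; rewrite /dunion_rel /=.
have [e|//] := eqVneq i j; case: _ / e b => b ab.
rewrite tagged_asE hE /=; have [_ _ -> //] := ccP i.
by apply: contraNneq ab => ->.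
Qed.

(** Complementing on the set [Y] given by the outermost bit leaves no edge between distinct balls of
    radius [n]. These balls are the components, and complementing on [Y] again restores [G]. *)
Lemma ultra_SC n G : ultra_graph n (@sc_rel n) G -> SC n G.
Proof.
elim: n G => [|n IH] G [h [col [hU h_le hP]]].
  have /card_gt0P [x _] := vertex_gt0 G.
  have all_x y : y = x.
    by apply/eqP; rewrite -(um_le0 hU).
  exists (fun=> tt); split=> [|y z]; first by exists (fun=> x) => [y|[]].
  by rewrite (all_x y) (all_x z) !adj_irrefl.
pose Y := [set x | (col x).1]; pose G' := lcompl Y.
have adjY (x y : G) : x != y ->
    @adj G' x y = (h x y <= n) && sc_rel (h x y) (col x).2 (col y).2.
  by move=> xy; rewrite lcompl_adj // hP //= !inE addKb.
have /card_gt0P [x0 _] := vertex_gt0 G.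
pose R := [set x | urep h n x == x].
have urepR x : urep h n x \in R by rewrite inE (urep_id hU).
have [k Rk] : exists k, #|R| = k.+1.
  exists #|R|.-1; rewrite prednK //; apply/card_gt0P; exists (urep h n x0).
  exact: urepR.
(* One centre for each ball of radius [n], indexed as [dunion] demands. *)
pose e (i : 'I_k.+1) : G := enum_val (cast_ord (esym Rk) i).
have e_inj i j : h (e i) (e j) <= n -> i = j.
  rewrite -(urep_eq hU); have eR l : urep h n (e l) = e l.
    by apply/eqP; have := enum_valP (cast_ord (esym Rk) l); rewrite inE.
  by rewrite !eR => /eqP /enum_val_inj /cast_ord_inj.
have e_onto x : exists i, e i = urep h n x.
  exists (cast_ord Rk (enum_rank_in (urepR x) (urep h n x))).
  by rewrite /e cast_ordK enum_rankK_in.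
pose B i : {set G'} := [set y | h (e i) y <= n].
have B_gt0 i : 0 < #|B i|.
  by apply/card_gt0P; exists (e i); rewrite inE (um_refl hU).
pose H i := induced (B_gt0 i).
pose g (z : dunion H) : G := val (tagged z).
have gB z : h (e (tag z)) (g z) <= n by have := valP (tagged z); rewrite inE.
have g_tag z w : (tag z == tag w) = (h (g z) (g w) <= n).
  rewrite -(um_lel hU _ (gB z)) -(um_ler hU _ (gB w)).
  by apply/eqP/idP => [->|/e_inj //]; rewrite (um_refl hU).
have g_inj : injective g.
  move=> z w e_zw; have /eqP := g_tag z w; rewrite e_zw (um_refl hU) leq0n => /eqP/eqP.
  case: z w e_zw => [i a] [j b] /= e_ab ij; case: _ / ij b e_ab => b.
  by rewrite /g /= => /val_inj ->.
have g_onto x : exists z, g z = x.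
  have [i ei] := e_onto x.
  have xB : x \in B i by rewrite inE ei (um_sym hU) (urep_le hU).
  by exists (Tagged (fun i => H i : Type) (Sub x xB : H i)).
have [f fK] := fin_all_exists g_onto.
exists k, H, [set z | g z \in Y]; split=> [i|].
  apply: IH; exists (fun x y : H i => h (val x) (val y)), (fun x => (col (val x)).2).
  split=> [|x y|x y xy].
  - split=> [x y|x y|l x y z]; first by rewrite (um_eq0 hU).
      exact: (um_sym hU).
    exact: (um_trans hU).
  - have := valP x; have := valP y; rewrite !inE => yB xB.
    by rewrite -(um_lel hU _ xB).
  - rewrite [LHS]adjY //; have := valP x; have := valP y; rewrite !inE => yB xB.
    by rewrite -(um_lel hU _ xB) yB.
exists f; split=> [|x y].
  by exists g => // z; apply: g_inj; rewrite fK.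
have f_inj : injective f by apply: can_inj fK.
have [<-|xy] := eqVneq x y; first by rewrite !adj_irrefl.
rewrite lcompl_adj ?(inj_eq f_inj) // !inE !fK.
suff -> : adj (f x) (f y) = @adj G' x y by rewrite lcompl_adj // !inE addKb.
rewrite -{2}(fK x) -{2}(fK y) /= /dunion_rel.
have [ef|nef] := eqVneq (tag (f x)) (tag (f y)).
  rewrite /g; case: (f x) (f y) ef => [i a] [j b] /= ij.
  by case: _ / ij b => b; rewrite tagged_asE.
rewrite -[RHS]/(@adj G' (g (f x)) (g (f y))) !fK adjY //.
by have := g_tag (f x) (f y); rewrite !fK (negPf nef) => <-.
Qed.

Theorem SC_finite_obstructions n : exists (k : nat) (F : 'I_k -> graph),
  forall G, SC n G <-> ~ exists i : 'I_k, has_induced G (F i).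
Proof.
apply: (@finite_obstructions n _ (@sc_rel n)) => [G H /SC_ultra GU GH|G].
  by apply: ultra_SC; apply: ultra_graph_hereditary GH.
exact: SC_ultra.
Qed.

Theorem theorem3p10 :
  (forall d m : nat, exists (k : nat) (F : 'I_k -> graph),
     forall G : graph, TM d m G <-> ~ exists i : 'I_k, has_induced G (F i)) /\
  (forall n : nat, exists (k : nat) (F' : 'I_k -> graph),
     forall G : graph, SC n G <-> ~ exists i : 'I_k, has_induced G (F' i)).
Proof.
split; [exact: TM_finite_obstructions | exact: SC_finite_obstructions].
Qed.
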